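(* Let $\Gamma$ be an amenable discrete group and let $\omega : \Gamma \to (0,\infty)$ be a weight function, i.e. $\omega(xy) \le \omega(x)\omega(y)$ for all $x,y \in \Gamma$. Then the weighted convolution algebra $\ell^1(\Gamma,\omega)$ is directly finite: whenever $a, b \in \ell^1(\Gamma,\omega)$ satisfy $a*b = \delta_e$, they also satisfy $b*a = \delta_e$.
   Context: For a discrete group $\Gamma$ with identity $e$ and a weight function $\omega$ on $\Gamma$, $\ell^1(\Gamma,\omega)$ is the unital Banach algebra of all functions $a : \Gamma \to \mathbb{C}$ with $\sum_{x \in \Gamma} |a(x)|\,\omega(x) < \infty$, with convolution product $(a*b)(z) = \sum_{y\in\Gamma} a(zy^{-1}) b(y)$ and unit $\delta_e$ (the indicator function of $\{e\}$). *)

(* Defs.v *)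
From HB Require Import structures.
From mathcomp Require Import all_boot all_order all_algebra.
From mathcomp Require Import complex.
From mathcomp Require Import all_classical all_reals all_analysis.
From mathcomp.analysis.showcase Require summability.

Set Implicit Arguments.
Unset Strict Implicit.
Unset Printing Implicit Defensive.

Import Order.TTheory GRing.Theory Num.Theory.
Import numFieldNormedType.Exports.

Local Open Scope classical_set_scope.
Local Open Scope ring_scope.

(* The functional [m] stands for a mean on the space of bounded real functions
   on [G]; its values on unbounded functions are irrelevant. *)
Definition left_invariant_mean (R : realType) (G : groupType)
    (m : (G -> R) -> R) : Prop :=
  [/\ forall (c : R) (f g : G -> R), bounded_fun f -> bounded_fun g ->
        m (fun x => c * f x + g x) = c * m f + m g,
      forall f : G -> R, bounded_fun f -> (forall x, 0 <= f x) -> 0 <= m f,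
      m (fun=> 1) = 1 &
      forall (s : G) (f : G -> R), bounded_fun f ->
        m (fun x => f (s^-1 * x)%g) = m f].

Definition amenable (R : realType) (G : groupType) : Prop :=
  exists m : (G -> R) -> R, left_invariant_mean m.

Definition weight (R : realType) (G : groupType) (w : G -> R) : Prop :=
  (forall x, 0 < w x) /\ (forall x y, w (x * y)%g <= w x * w y).

(* [Normc.normc] is the modulus with values in [R], whereas [`|_|] on [R[i]]
   takes its values in [R[i]]. *)
Definition weighted_l1 (R : realType) (G : groupType) (w : G -> R) : set (G -> R[i]) :=
  [set a | (\esum_(x in [set: G]) (Normc.normc (a x) * w x)%:E < +oo)%E].

(* [summability.sum] is the unordered sum: the limit of the sums over finite
   subsets along inclusion. [R[i]^o] carries the topology of the modulus. *)
Definition convolution (R : realType) (G : groupType) (a b : G -> R[i]) : G -> R[i] :=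
  fun z => summability.sum (fun y => a (z * y^-1)%g * b y : R[i]^o).

Definition delta_e (R : realType) (G : groupType) : G -> R[i] :=
  fun x => (x == 1%g)%:R.
Arguments delta_e : clear implicits.

(* Main.v *)
Require Import Defs.
From HB Require Import structures.
From mathcomp Require Import all_boot all_order all_algebra finmap.
From mathcomp Require Import complex.
From mathcomp Require Import all_classical all_reals all_analysis.
From mathcomp Require Import ring lra.
From mathcomp.analysis.showcase Require summability.

(* Averaging [ln (w (x * y)) - ln (w y)] over [y] with the invariant mean gives
   a homomorphism [ln \o chi] from [G] to the reals with [chi <= w].
   Multiplication by [chi] is an injective algebra morphism from l^1(G, w) to
   l^1(G), so it suffices to treat the trivial weight. There [T f = Re (f 1)] is
   a faithful positive trace. If [a * b = 1] then [f = 1 - b * a] is an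
   idempotent with [T f = 1 - T (a * b) = 0], and such an idempotent vanishes
   (Kaplansky; the argument, due to Passman, minimizes the l^2-distance from [1]
   to the right ideal generated by [f]). *)

Set Implicit Arguments.
Unset Strict Implicit.
Unset Printing Implicit Defensive.
Import Order.TTheory GRing.Theory Num.Theory.
Import numFieldNormedType.Exports.

Local Open Scope classical_set_scope.
Local Open Scope ring_scope.

(** * Idempotents in tracial star-algebras *)

Lemma sqr_le_of_quadratic (R : realType) (e B Q : R) : 0 <= Q ->
  (forall t, - e <= 2 * t * B + t ^+ 2 * Q) -> B ^+ 2 <= e * Q.
Proof.
move=> Q0 H; have [Q_eq0|Qn0] := eqVneq Q 0.
  rewrite Q_eq0 mulr0; have [->|Bn0] := eqVneq B 0; first by rewrite expr0n.
  (* With Q = 0 the right side is linear in t; this t gives it the value -(e + 1), below the allowed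
     -e. *)
  have := H (- (e + 1) / (2 * B)); rewrite Q_eq0 mulr0 addr0.
  have -> : 2 * (- (e + 1) / (2 * B)) * B = - (e + 1).
    by field.
  by move=> h; exfalso; lra.
have Qp : 0 < Q by rewrite lt_def Qn0.
have := H (- B / Q).
have -> : 2 * (- B / Q) * B + (- B / Q) ^+ 2 * Q = - (B ^+ 2 / Q) by field.
by rewrite lerN2 ler_pdivrMr.
Qed.

Section TracialStarAlgebra.
Variables (R : realType) (A : algType R) (star : A -> A) (T : A -> R).
Hypothesis starD : {morph star : x y / x + y}.
Hypothesis starZ : forall c x, star (c *: x) = c *: star x.
Hypothesis starM : forall x y, star (x * y) = star y * star x.
Hypothesis starK : involutive star.
Hypothesis TD : {morph T : x y / x + y}.
Hypothesis TZ : forall c x, T (c *: x) = c * T x.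
Hypothesis T1 : T 1 = 1.
Hypothesis TC : forall x y, T (x * y) = T (y * x).
Hypothesis Tstar : forall x, T (star x) = T x.
Hypothesis T_ge0 : forall x, 0 <= T (x * star x).
Hypothesis T_eq0 : forall x, T (x * star x) = 0 -> x = 0.
Hypothesis T_bounded : forall g, exists K, forall x,
  T (x * g * star x) <= K * T (x * star x).

Local Notation "<< x , y >>" := (T (x * star y)).

Let TN x : T (- x) = - T x.
Proof. by rewrite -scaleN1r TZ mulN1r. Qed.

Let TB x y : T (x - y) = T x - T y.
Proof. by rewrite TD TN. Qed.

Let starN x : star (- x) = - star x.
Proof. by rewrite -scaleN1r starZ scaleN1r. Qed.

Let star1 : star 1 = 1.
Proof. by rewrite -[LHS]mulr1 -{2}(starK 1) -starM mulr1 starK. Qed.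

Let formC x y : <<x, y>> = <<y, x>>.
Proof. by rewrite -Tstar starM starK. Qed.

Let form_line x y t :
  <<x + t *: y, x + t *: y>> = <<x, x>> + 2 * t * <<x, y>> + t ^+ 2 * <<y, y>>.
Proof.
rewrite starD starZ mulrDl !mulrDr !TD -!(scalerAl t y) -(scalerAr t x).
rewrite -(scalerAr t y) !TZ (formC y x).
ring.
Qed.

Let cauchy_schwarz x y : <<x, y>> ^+ 2 <= <<x, x>> * <<y, y>>.
Proof.
apply: sqr_le_of_quadratic => // t.
by have := T_ge0 (x + t *: y); rewrite form_line; lra.
Qed.

Section Idempotent.
Variable f : A.
Hypothesis ff : f * f = f.
Hypothesis Tf : T f = 0.

Let cost y := <<f * y - 1, f * y - 1>>.

(* If the residual [f * y - 1] is almost orthogonal to the right ideal [f * A]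
   then [(f * y - 1) * f], which lies in that ideal, is almost zero; taking
   traces, [T (f * y)] is close to [T f = 0], and so [f * y] contributes almost
   nothing to the approximation of [1]. *)
Let almost_orthogonal K e y : 0 < e -> e <= 1 -> 1 <= K ->
  (forall x, <<x * (f * star f), x * (f * star f)>> <= K * <<x, x>>) ->
  cost y <= 2 ->
  (forall z, <<f * y - 1, f * z>> ^+ 2 <= e ^+ 4 * <<f * z, f * z>>) ->
  1 <= cost y + (2 * K + 4) * e.
Proof.
rewrite /cost; set v := f * y - 1 => e0 e1 K1 HK c2 H.
have vfE : v * f = f * (y * f - 1).
  by rewrite /v mulrBl mulrBr mulr1 mul1r mulrA.
have q_vf : <<v * f, v * f>> = <<v, v * (f * star f)>>.
  by rewrite !starM starK !mulrA.
have vffE : v * (f * star f) = f * ((y * f - 1) * star f).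
  by rewrite mulrA vfE !mulrA.
have h1 : <<v * f, v * f>> ^+ 2 <= e ^+ 4 * (2 * K).
  rewrite q_vf vffE; apply: (le_trans (H _)).
  rewrite ler_pM2l ?exprn_gt0// -vffE; apply: (le_trans (HK _)).
  by rewrite mulrC ler_pM2r//; lra.
have Tvf : <<v * f, 1>> = T (f * y).
  by rewrite star1 mulr1 /v mulrBl mul1r TB Tf subr0 [LHS]TC mulrA ff.
have h2 : T (f * y) ^+ 2 <= <<v * f, v * f>>.
  rewrite -Tvf; apply: (le_trans (cauchy_schwarz _ _)).
  by rewrite star1 mulr1 T1 mulr1.
(* [h2] and [h1] combine to T (f y)^4 <= 2 K e^4; these two squarings are why the tolerance is a
   fourth power. Since 2 K >= 1, replacing the fourth root of 2 K by 2 K only weakens the bound. *)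
have h3 : T (f * y) <= 2 * K * e.
  rewrite leNgt; apply/negP => lt.
  have p0 : 0 < 2 * K * e by rewrite !mulr_gt0//; lra.
  have : (2 * K * e) ^+ 4 < T (f * y) ^+ 4.
    by rewrite ltrXn2r ?nnegrE// ltW// (lt_trans p0).
  apply/negP; rewrite -leNgt (_ : 4%N = (2 * 2)%N)// exprM.
  apply: (@le_trans _ _ (<<v * f, v * f>> ^+ 2)).
    by rewrite lerXn2r ?nnegrE ?sqr_ge0.
  apply: (le_trans h1); rewrite exprMn [leRHS]mulrC ler_pM2l ?exprn_gt0//.
  by rewrite ler_eXnr//; lra.
(* Since f y = v + 1 and [<<v, v>>] is at most 2, the square norm of f y is at most 6; it is rounded
   up to the perfect square 9 so that the root of 9 e^4 is 3 e^2. *)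
have h4 : - <<v, f * y>> <= 3 * e ^+ 2.
  have xx : <<f * y, f * y>> <= 9.
    have := form_line v 1 1; rewrite scale1r /v subrK => ->; rewrite -/v.
    have := cauchy_schwarz v 1; rewrite star1 !mulr1 T1 mulr1.
    move: (T v) (<<v, v>>) c2 (sqr_ge0 (T v - 1)) => s q.
    rewrite expr1n mul1r => H1 H2 H3; nra.
  rewrite leNgt; apply/negP => lt.
  have := H y; apply/negP; rewrite -ltNge.
  apply: (@le_lt_trans _ _ (e ^+ 4 * 9)); first by rewrite ler_pM2l ?exprn_gt0.
  move: lt; have := exprn_gt0 2 e0; rewrite (exprM e 2 2).
  move: (e ^+ 2) (<<v, f * y>>) => e2 s p lt; rewrite -subr_gt0.
  rewrite (_ : _ - _ = (- s - 3 * e2) * (- s + 3 * e2)); last by ring.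
  by rewrite mulr_gt0//; lra.
have -> : <<v, v>> = <<v, f * y>> - T (f * y) + 1.
  rewrite {2}/v starD starN star1 mulrBr mulr1 TB {2}/v TB T1; lra.
nra.
Qed.

(** If the infimum were below 1, take z with cost within e^4 of it. Moving from z to z + t u cannot
    lower the cost by more than e^4 for any t, so the discriminant bound makes the residual almost
    orthogonal to f A, and [almost_orthogonal] pushes the cost of z too close to 1. *)
Let cost_ge1 y : 1 <= cost y.
Proof.
pose E := [set cost y | y in [set: A]].
have E0 : E !=set0 by exists (cost 0), 0.
have lbE : lbound E 0 by move=> _ [z _ <-]; exact: T_ge0.
have infE : has_inf E by split => //; exists 0.
suff : 1 <= inf E.
  by move=> /le_trans; apply; apply: ge_inf; [exists 0|exists y].
have [K HK] := T_bounded (f * star f * star (f * star f)).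
pose K' := Num.max 1 K.
have K1 : 1 <= K' by rewrite /K' le_max lexx.
have HK' x : <<x * (f * star f), x * (f * star f)>> <= K' * <<x, x>>.
  rewrite starM !mulrA -!(mulrA x) -(mulrA f) (mulrA _ _ (star x)).
  move: (HK x); rewrite !mulrA => /le_trans -> //.
  by apply: ler_wpM2r => //; rewrite le_max lexx orbT.
have inf1 : inf E <= 1.
  apply: ge_inf; first by exists 0.
  by exists 0 => //; rewrite /cost mulr0 sub0r starN star1 mulrNN mulr1.
rewrite leNgt; apply/negP => inf_lt1.
(* The coefficient 2 K' + 4 of [almost_orthogonal], plus 1 to absorb e^4 <= e; then M e is exactly
   the gap 1 - inf E. *)
pose M := 2 * K' + 5.
have M0 : 0 < M by rewrite /M; lra.
pose e := (1 - inf E) / M.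
have inf0 : 0 <= inf E by apply: lb_le_inf.
have e0 : 0 < e by rewrite divr_gt0// subr_gt0.
have e1 : e <= 1 by rewrite ler_pdivrMr// mul1r /M; lra.
have e40 : 0 < e ^+ 4 by rewrite exprn_gt0.
have [_ [z _ <-] Hz] := inf_adherent e40 infE.
have e4e : e ^+ 4 <= e by rewrite ler_iXnr// ltW.
have Me : M * e = 1 - inf E by rewrite /e mulrC divfK// gt_eqF.
suff : 1 <= cost z + (2 * K' + 4) * e.
  have : M * e = (2 * K' + 4) * e + e by rewrite /M; ring.
  lra.
apply: almost_orthogonal => //; first by lra.
move=> u; apply: sqr_le_of_quadratic => // t.
have : inf E <= cost (z + t *: u) by apply: ge_inf; [exists 0|eexists].
rewrite /cost mulrDr -(scalerAr t f) addrAC form_line -/(cost z); lra.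
Qed.

Lemma idempotent_trace0 : f = 0.
Proof.
apply: T_eq0.
apply/eqP; rewrite -sqrf_eq0 eq_le sqr_ge0 andbT.
rewrite -[leRHS](mul0r <<f * star f, f * star f>>).
rewrite -sqrrN; apply: sqr_le_of_quadratic => // t.
have := cost_ge1 (t *: star f); rewrite /cost -(scalerAr t f) addrC form_line.
rewrite starN star1 mulrNN mulr1 T1 mulN1r TN Tstar; lra.
Qed.

End Idempotent.

Lemma tracial_directly_finite (a b : A) : a * b = 1 -> b * a = 1.
Proof.
move=> ab; have idem : (1 - b * a) * (1 - b * a) = 1 - b * a.
  rewrite mulrBr mulr1 mulrBl mul1r -mulrA [a * _]mulrA ab mul1r subrr subr0.
  by [].
have tr0 : T (1 - b * a) = 0 by rewrite TB TC ab subrr.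
by apply/esym/eqP; rewrite -subr_eq0; apply/eqP/idempotent_trace0.
Qed.

End TracialStarAlgebra.

(** * Unordered sums *)

Section NonnegativeSums.
Variable R : realType.
Implicit Types (T U : choiceType).

Lemma esum_fin_num_at T (X : T -> \bar R) : (forall x, (0 <= X x)%E) ->
  (\esum_(x in [set: T]) X x < +oo)%E -> forall x, X x \is a fin_num.
Proof.
move=> X0 sX x; rewrite ge0_fin_numE//.
have /summable_pinfty : summable [set: T] X.
  by rewrite /summable; under eq_esum do rewrite gee0_abs//.
by move=> /(_ x I); rewrite gee0_abs.
Qed.

Lemma ge0_esumZl T (c : R) (X : T -> \bar R) : 0 <= c ->
  (forall x, (0 <= X x)%E) ->
  (\esum_(x in [set: T]) (c%:E * X x) = c%:E * \esum_(x in [set: T]) X x)%E.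
Proof.
have le k (Y : T -> \bar R) : 0 <= k -> (forall x, (0 <= Y x)%E) ->
    (\esum_(x in [set: T]) (k%:E * Y x) <= k%:E * \esum_(x in [set: T]) Y x)%E.
  move=> k0 Y0; rewrite ge_ereal_sup => //= _ [A [finA _]] <-.
  rewrite -ge0_mule_fsumr//; apply: lee_wpmul2l; first by rewrite lee_fin.
  by apply: esum_ge; exists A.
(* The converse inequality is [le] again, for the scalar c^-1 and the family c X. *)
move=> c0 X0; apply/eqP; rewrite eq_le le//=.
have [->|cn0] := eqVneq c 0.
  by rewrite mul0e; apply: esum_ge0 => x _; rewrite mul0e.
rewrite -lee_pdivlMl ?lt_def ?cn0//; apply: le_trans (le _ _ _ _); last 2 first.
- by rewrite invr_ge0.
- by move=> x; apply: mule_ge0.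
by apply: le_esum => x _; rewrite muleA -EFinM mulVf// mul1e.
Qed.

Lemma exchange_esum T U (X : T -> U -> \bar R) :
  (forall x y, (0 <= X x y)%E) ->
  (\esum_(x in [set: T]) \esum_(y in [set: U]) X x y =
   \esum_(y in [set: U]) \esum_(x in [set: T]) X x y)%E.
Proof.
move=> X0; rewrite !esum_esum//.
rewrite (reindex_esum ([set: U] `*`` fun=> [set: T]) _ (fun p => (p.2, p.1)))//.
split => //=.
- by move=> [x y] [u v] _ _ [-> ->].
- by move=> [x y] _; exists (y, x).
Qed.

(** [fine] sends a divergent sum to 0, so additivity and comparison are stated under
    [abs_summable]. *)
Definition psum T (f : T -> R) : R := fine (\esum_(x in [set: T]) (f x)%:E).

Definition abs_summable T (f : T -> R) :=
  (\esum_(x in [set: T]) `|f x|%:E < +oo)%E.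

Lemma EFin_psum T (f : T -> R) : (forall x, 0 <= f x) ->
  abs_summable f -> (psum f)%:E = (\esum_(x in [set: T]) (f x)%:E)%E.
Proof.
move=> f0 sf; rewrite /psum fineK// ge0_fin_numE; last first.
  by apply: esum_ge0 => x _; rewrite lee_fin.
by apply: le_lt_trans sf; apply: le_esum => x _; rewrite lee_fin ler_norm.
Qed.

Lemma abs_summable_le T (f g : T -> R) : abs_summable g ->
  (forall x, `|f x| <= `|g x|) -> abs_summable f.
Proof.
move=> sg fg; apply: le_lt_trans sg; apply: le_esum => x _.
by rewrite lee_fin.
Qed.

Lemma abs_summableD T (f g : T -> R) : abs_summable f -> abs_summable g ->
  abs_summable (fun x => f x + g x).
Proof.
move=> sf sg; apply: (@le_lt_trans _ _
    (\esum_(x in [set: T]) (`|f x|%:E + `|g x|%:E))%E).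
  by apply: le_esum => x _; rewrite -EFinD lee_fin ler_normD.
by rewrite esumD ?lte_add_pinfty// => x _; rewrite lee_fin.
Qed.

Lemma abs_summableZ T (c : R) (f : T -> R) : abs_summable f ->
  abs_summable (fun x => c * f x).
Proof.
move=> sf; rewrite /abs_summable.
under eq_esum do rewrite normrM EFinM.
by rewrite ge0_esumZl// lte_mul_pinfty// lee_fin.
Qed.

Lemma abs_summable_norm T (f : T -> R) : abs_summable f ->
  abs_summable (fun x => `|f x|).
Proof. by move=> sf; apply: abs_summable_le sf _ => x; rewrite normr_id. Qed.

Lemma psum_ge0 T (f : T -> R) : (forall x, 0 <= f x) -> 0 <= psum f.
Proof. by move=> f0; apply/fine_ge0/esum_ge0 => x _; rewrite lee_fin. Qed.

Lemma psumD T (f g : T -> R) : (forall x, 0 <= f x) -> (forall x, 0 <= g x) ->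
  abs_summable f -> abs_summable g ->
  psum (fun x => f x + g x) = psum f + psum g.
Proof.
move=> f0 g0 sf sg; apply: EFin_inj.
rewrite EFinD !EFin_psum//; last exact: abs_summableD.
  by rewrite -esumD// => x _; rewrite lee_fin.
by move=> x; apply: addr_ge0.
Qed.

Lemma psumZ T (c : R) (f : T -> R) : 0 <= c -> (forall x, 0 <= f x) ->
  abs_summable f -> psum (fun x => c * f x) = c * psum f.
Proof.
move=> c0 f0 sf; apply: EFin_inj; rewrite EFinM !EFin_psum//.
- by rewrite -ge0_esumZl.
- by move=> x; apply: mulr_ge0.
- exact: abs_summableZ.
Qed.

Lemma le_psum T (f g : T -> R) : (forall x, 0 <= f x) ->
  (forall x, f x <= g x) -> abs_summable g -> psum f <= psum g.
Proof.
move=> f0 fg sg; have g0 x : 0 <= g x by apply: le_trans (fg x).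
rewrite -lee_fin !EFin_psum//; first by apply: le_esum => x _; rewrite lee_fin.
by apply: abs_summable_le sg _ => x; rewrite !ger0_norm.
Qed.

Lemma psum_ge_at T (f : T -> R) x : (forall x, 0 <= f x) ->
  abs_summable f -> f x <= psum f.
Proof.
move=> f0 sf; rewrite -lee_fin EFin_psum//.
by apply: esum_ge; exists [set x] => //; rewrite fsbig_set1.
Qed.

Lemma psum_bij T U (e : T -> U) (f : U -> R) : bijective e ->
  psum (f \o e) = psum f.
Proof.
move=> be; congr fine; apply/esym/reindex_esum; split => //.
- by move=> x y _ _; apply: bij_inj.
- by case: be => g _ ge x _; exists (g x).
Qed.

Lemma abs_summable_bij T U (e : T -> U) (f : U -> R) : bijective e ->
  abs_summable f -> abs_summable (f \o e).
Proof.
move=> be; rewrite /abs_summable (reindex_esum [set: T] _ e)//; split => //.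
- by move=> x y _ _; apply: bij_inj.
- by case: be => g _ ge x _; exists (g x).
Qed.

Definition abs_summable2 T U (F : T -> U -> R) :=
  (\esum_(x in [set: T]) \esum_(y in [set: U]) `|F x y|%:E < +oo)%E.

Lemma abs_summable2C T U (F : T -> U -> R) : abs_summable2 F ->
  abs_summable2 (fun y x => F x y).
Proof. by rewrite /abs_summable2 exchange_esum. Qed.

Lemma abs_summable2_le T U (F H : T -> U -> R) : abs_summable2 H ->
  (forall x y, `|F x y| <= `|H x y|) -> abs_summable2 F.
Proof.
move=> sH FH; apply: le_lt_trans sH; apply: le_esum => x _.
by apply: le_esum => y _; rewrite lee_fin.
Qed.

Lemma abs_summable2_at T U (F : T -> U -> R) x : abs_summable2 F ->
  abs_summable (F x).
Proof.
have e0 z : (0 <= \esum_(y in [set: U]) `|F z y|%:E)%E.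
  by apply: esum_ge0 => y _; rewrite lee_fin.
move=> sF; rewrite /abs_summable -ge0_fin_numE//.
exact: esum_fin_num_at sF _.
Qed.

Lemma abs_summable_psum T U (F : T -> U -> R) : abs_summable2 F ->
  abs_summable (fun x => psum (fun y => `|F x y|)).
Proof.
move=> sF; apply: le_lt_trans (sF); apply: le_esum => x _.
rewrite ger0_norm ?psum_ge0// EFin_psum//.
by apply: abs_summable_norm; apply: abs_summable2_at.
Qed.

Lemma abs_summable2_psum T U (F : T -> U -> R) :
  (forall x, abs_summable (F x)) ->
  abs_summable (fun x => psum (fun y => `|F x y|)) -> abs_summable2 F.
Proof.
move=> sF; apply: le_lt_trans; apply: le_esum => x _.
rewrite ger0_norm ?psum_ge0// EFin_psum//; exact: abs_summable_norm.
Qed.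

Lemma exchange_psum T U (F : T -> U -> R) : (forall x y, 0 <= F x y) ->
  abs_summable2 F ->
  psum (fun x => psum (fun y => F x y)) = psum (fun y => psum (fun x => F x y)).
Proof.
have H (V W : choiceType) (H : V -> W -> R) : (forall x y, 0 <= H x y) ->
    abs_summable2 H ->
    psum (fun x => psum (fun y => H x y)) =
    fine (\esum_(x in [set: V]) \esum_(y in [set: W]) (H x y)%:E)%E.
  move=> H0 sH; congr fine; apply: eq_esum => x _.
  by rewrite EFin_psum//; apply: abs_summable2_at.
move=> F0 sF; rewrite !H//; last exact: abs_summable2C.
by rewrite exchange_esum// => x y; rewrite lee_fin.
Qed.

End NonnegativeSums.

(** * Sums of signed families and Fubini's theorem *)

Section RealSums.
Variable R : realType.
Implicit Types (T U : choiceType).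

(* Both functions summed on the right are nonnegative, so that [rsum] is linear
   as soon as [psum] is additive. *)
Definition rsum T (f : T -> R) : R :=
  psum (fun x => `|f x| + f x) - psum (fun x => `|f x|).

Let abs_add_ge0 (x : R) : 0 <= `|x| + x.
Proof. by have := lerNnormlW (lexx `|x|); lra. Qed.

(** With h = f - g, the identity (|h| + h) + g = |h| + f has only nonnegative terms and can be
    summed by [psumD]. So [rsum] may be computed from any splitting into nonnegative summable parts,
    from which linearity and Fubini follow. *)
Lemma rsumB T (f g : T -> R) : (forall x, 0 <= f x) -> (forall x, 0 <= g x) ->
  abs_summable f -> abs_summable g ->
  rsum (fun x => f x - g x) = psum f - psum g.
Proof.
move=> f0 g0 sf sg.
have sN : abs_summable (fun x => - g x).
  by apply: abs_summable_le sg _ => x; rewrite normrN.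
have s := abs_summableD sf sN; have sn := abs_summable_norm s.
apply/eqP; rewrite subr_eq addrAC eq_sym subr_eq addrC eq_sym; apply/eqP.
rewrite -!psumD//; last exact: abs_summableD.
by congr psum; apply/funext => x /=; ring.
Qed.

Lemma rsum_ge0E T (f : T -> R) : (forall x, 0 <= f x) -> abs_summable f ->
  rsum f = psum f.
Proof.
move=> f0 sf; rewrite /rsum psumD//; last exact: abs_summable_norm.
by rewrite addrAC subrr add0r.
Qed.

Lemma rsumD T (f g : T -> R) : abs_summable f -> abs_summable g ->
  rsum (fun x => f x + g x) = rsum f + rsum g.
Proof.
move=> sf sg; have nf := abs_summable_norm sf; have ng := abs_summable_norm sg.
have df := abs_summableD nf sf; have dg := abs_summableD ng sg.
have ddfg := abs_summableD df dg; have dnfg := abs_summableD nf ng.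
rewrite {2 3}/rsum addrACA -opprD -!psumD// -rsumB//.
- by congr rsum; apply/funext => x; ring.
- by move=> x; apply: addr_ge0; apply: abs_add_ge0.
Qed.

Lemma rsumN T (f : T -> R) : abs_summable f ->
  rsum (fun x => - f x) = - rsum f.
Proof.
move=> sf; have nf := abs_summable_norm sf.
rewrite {2}/rsum opprB -rsumB//; last exact: abs_summableD.
by congr rsum; apply/funext => x; ring.
Qed.

Lemma rsumZ T c (f : T -> R) : abs_summable f ->
  rsum (fun x => c * f x) = c * rsum f.
Proof.
wlog c0 : c / 0 <= c.
  move=> H sf; have [/H ->//|c0] := leP 0 c.
  have /H : 0 <= - c by lra.
  move=> /(_ sf); rewrite mulNr => /eqP; rewrite -eqr_oppLR => /eqP <-.
  rewrite -rsumN; last exact: abs_summableZ.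
  by congr rsum; apply/funext => x; ring.
move=> sf; have nf := abs_summable_norm sf.
have df := abs_summableD nf sf.
have zn := abs_summableZ c nf; have zd := abs_summableZ c df.
rewrite {2}/rsum mulrBr -!psumZ// -rsumB//.
- by congr rsum; apply/funext => x; ring.
- by move=> x; apply: mulr_ge0 => //; apply: abs_add_ge0.
- by move=> x; apply: mulr_ge0 => //; apply: abs_add_ge0.
Qed.

Lemma rsum_le_norm T (f : T -> R) : abs_summable f ->
  `|rsum f| <= psum (fun x => `|f x|).
Proof.
have le g : abs_summable g -> rsum g <= psum (fun x : T => `|g x|).
  move=> sg; have ng := abs_summable_norm sg.
  rewrite /rsum lerBlDr -psumD//; apply: le_psum; last exact: abs_summableD.
    by move=> x; apply: abs_add_ge0.
  by move=> x; rewrite lerD2l ler_norm.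
move=> sf; rewrite ler_norml le// andbT lerNl -rsumN//.
have -> : (fun x => `|f x|) = (fun x => `|- f x|).
  by apply/funext => x; rewrite normrN.
by apply: le; apply: abs_summable_le sf _ => x; rewrite normrN.
Qed.

Lemma rsum_bij T U (e : T -> U) (f : U -> R) : bijective e ->
  rsum (f \o e) = rsum f.
Proof.
move=> be; rewrite /rsum -(psum_bij (fun x => `|f x|) be).
by rewrite -(psum_bij (fun x => `|f x| + f x) be).
Qed.

(** Tonelli is applied separately to |F| + F, dominated by 2 |F|, and to |F|; [rsumB] recognizes the
    iterated [rsum] as the difference of the two iterated [psum]. *)
Lemma exchange_rsum T U (F : T -> U -> R) : abs_summable2 F ->
  rsum (fun x => rsum (fun y => F x y)) = rsum (fun y => rsum (fun x => F x y)).
Proof.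
move=> sF.
have sN : abs_summable2 (fun x y => `|F x y|).
  by apply: abs_summable2_le sF _ => x y; rewrite normr_id.
have sD : abs_summable2 (fun x y => `|F x y| + F x y).
  apply: (@abs_summable2_le _ _ _ _ (fun x y => 2 * `|F x y|)).
    rewrite /abs_summable2; under eq_esum do under eq_esum do
      rewrite normrM normr_id EFinM.
    under eq_esum do rewrite ge0_esumZl//.
    rewrite ge0_esumZl//; last by move=> x; apply: esum_ge0.
    by rewrite lte_mul_pinfty//.
  move=> x y; rewrite normrM normr_id ger0_norm ?abs_add_ge0//.
  by rewrite ger0_norm//; have := ler_norm (F x y); lra.
have H (V W : choiceType) (H : V -> W -> R) :
    abs_summable2 (fun x y => `|H x y|) ->
    abs_summable2 (fun x y => `|H x y| + H x y) ->
    rsum (fun x => rsum (fun y => H x y)) =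
    psum (fun x => psum (fun y => `|H x y| + H x y)) -
    psum (fun x => psum (fun y => `|H x y|)).
  move=> s1 s2; rewrite -rsumB//.
  - by move=> x; apply: psum_ge0.
  - by move=> x; apply: psum_ge0.
  - apply: abs_summable_le (abs_summable_psum s2) _ => x.
    by under [in leRHS]eq_fun do rewrite ger0_norm//.
  - apply: abs_summable_le (abs_summable_psum s1) _ => x.
    by under [in leRHS]eq_fun do rewrite normr_id.
rewrite !H//; try exact: abs_summable2C.
by rewrite exchange_psum// (exchange_psum _ sN).
Qed.

End RealSums.

(** * Splitting off finitely many terms *)

Section FiniteParts.
Variables (R : realType) (T : choiceType).

Lemma psum_approx (f : T -> R) (e : R) : 0 < e -> (forall x, 0 <= f x) ->
  abs_summable f ->
  exists A : {fset T}, psum f < \sum_(i <- A) f i + e.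
Proof.
move=> e0 f0 sf.
have fin : (\esum_(x in [set: T]) (f x)%:E)%E \is a fin_num.
  by rewrite -EFin_psum.
have [_ [A [finA _] <-] h] := ub_ereal_sup_adherent e0 fin.
exists (fset_set A); rewrite -ltrBlDr -lte_fin EFinB EFin_psum//.
by rewrite -sumEFin -fsbig_finite.
Qed.

Lemma esum_pt (g : T -> R) a : (forall x, x != a -> g x = 0) -> 0 <= g a ->
  (\esum_(x in [set: T]) (g x)%:E)%E = (g a)%:E.
Proof.
move=> g0 ga; rewrite -(@esum_set1 _ _ a (fun x => (g x)%:E)) ?lee_fin//.
rewrite [RHS]esum_mkcond; apply: eq_esum => x _.
by rewrite in_set1; case: eqVneq => // /g0 ->.
Qed.

Lemma rsum_pt (f : T -> R) a : (forall x, x != a -> f x = 0) -> rsum f = f a.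
Proof.
move=> f0.
have E1 : psum (fun x => `|f x| + f x) = `|f a| + f a.
  rewrite /psum (@esum_pt (fun x => `|f x| + f x) a)//.
    by move=> x /f0 ->; rewrite normr0 addr0.
  by have := lerNnormlW (lexx `|f a|); lra.
have E2 : psum (fun x => `|f x|) = `|f a|.
  rewrite /psum (@esum_pt (fun x => `|f x|) a)//.
  by move=> x /f0 ->; rewrite normr0.
by rewrite /rsum E1 E2 addrAC subrr add0r.
Qed.

Lemma rsum_split (f : T -> R) (s : seq T) : uniq s -> abs_summable f ->
  rsum f = \sum_(i <- s) f i + rsum (fun x => if x \in s then 0 else f x).
Proof.
move=> + sf; elim: s => [|a s IH] /=; first by rewrite big_nil add0r.
move=> /andP[as_ us]; rewrite (IH us) big_cons [f a + _]addrC -addrA; congr +%R.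
pose pt x := if x == a then f x else 0.
have <- : rsum pt = f a.
  by rewrite (@rsum_pt _ a) /pt ?eqxx// => x /negbTE ->.
rewrite -rsumD; last 2 first.
- by apply: abs_summable_le sf _ => x; rewrite /pt; case: ifP; rewrite ?normr0.
- by apply: abs_summable_le sf _ => x; case: ifP; rewrite ?normr0.
congr rsum; apply/funext => x; rewrite /pt inE.
by case: eqVneq => [->|_] /=; rewrite ?(negbTE as_) ?addr0 ?add0r.
Qed.

Lemma psum_split (f : T -> R) (s : seq T) : uniq s -> (forall x, 0 <= f x) ->
  abs_summable f ->
  psum f = \sum_(i <- s) f i + psum (fun x => if x \in s then 0 else f x).
Proof.
move=> us f0 sf; rewrite -!rsum_ge0E//; first exact: rsum_split.
- by move=> x; case: ifP.
- by apply: abs_summable_le sf _ => x; case: ifP; rewrite ?normr0.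
Qed.

End FiniteParts.

(** * Complex sums and their agreement with the unordered limit *)

Section ComplexSums.
Variable R : realType.
Implicit Types (T U : choiceType) (z : R[i]).
Local Notation Re := complex.Re.
Local Notation Im := complex.Im.
Local Notation normc := (@Normc.normc R).

Lemma normc_ge0 z : 0 <= normc z.
Proof. by case: z => x y; rewrite sqrtr_ge0. Qed.

Lemma norm_Re_le_normc z : `|Re z| <= normc z.
Proof.
by case: z => x y /=; rewrite -sqrtr_sqr ler_wsqrtr// lerDl sqr_ge0.
Qed.

Lemma norm_Im_le_normc z : `|Im z| <= normc z.
Proof.
by case: z => x y /=; rewrite -sqrtr_sqr ler_wsqrtr// lerDr sqr_ge0.
Qed.

Lemma normc_le_ReIm z : normc z <= `|Re z| + `|Im z|.
Proof.
case: z => x y /=; rewrite -[leRHS]ger0_norm ?addr_ge0// -sqrtr_sqr.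
apply: ler_wsqrtr; rewrite sqrrD !real_normK ?num_real// addrAC lerDl.
by rewrite mulrn_wge0// mulr_ge0.
Qed.

Lemma normc_conj z : normc (conjc z) = normc z.
Proof. by case: z => x y /=; rewrite sqrrN. Qed.

Definition csum T (f : T -> R[i]) : R[i] :=
  Complex (rsum (fun x => Re (f x))) (rsum (fun x => Im (f x))).

Definition csummable T (f : T -> R[i]) := abs_summable (fun x => normc (f x)).

Definition csummable2 T U (F : T -> U -> R[i]) :=
  abs_summable2 (fun x y => normc (F x y)).

Lemma csummable_Re T (f : T -> R[i]) : csummable f ->
  abs_summable (fun x => Re (f x)).
Proof.
move=> sf; apply: abs_summable_le sf _ => x.
by rewrite [leRHS]ger0_norm ?normc_ge0// norm_Re_le_normc.
Qed.

Lemma csummable_Im T (f : T -> R[i]) : csummable f ->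
  abs_summable (fun x => Im (f x)).
Proof.
move=> sf; apply: abs_summable_le sf _ => x.
by rewrite [leRHS]ger0_norm ?normc_ge0// norm_Im_le_normc.
Qed.

Lemma csummable_le T (f g : T -> R[i]) : csummable g ->
  (forall x, normc (f x) <= normc (g x)) -> csummable f.
Proof.
move=> sg fg; apply: abs_summable_le sg _ => x.
by rewrite !ger0_norm ?normc_ge0.
Qed.

Lemma csummableD T (f g : T -> R[i]) : csummable f -> csummable g ->
  csummable (fun x => f x + g x).
Proof.
move=> sf sg; apply: abs_summable_le (abs_summableD sf sg) _ => x.
by rewrite !ger0_norm ?addr_ge0 ?normc_ge0//; apply: le_normcD.
Qed.

Lemma csummableZ T c (f : T -> R[i]) : csummable f ->
  csummable (fun x => c * f x).
Proof.
move=> sf; apply: abs_summable_le (abs_summableZ (normc c) sf) _ => x.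
by rewrite Normc.normcM.
Qed.

Lemma csummableMr_bounded T (f g : T -> R[i]) (K : R) :
  (forall x, normc (f x) <= K) -> csummable g ->
  csummable (fun x => f x * g x).
Proof.
move=> fK sg; apply: abs_summable_le (abs_summableZ K sg) _ => x.
rewrite Normc.normcM !normrM ler_wpM2r// ger0_norm ?normc_ge0//.
by rewrite (le_trans (fK x))// ler_norm.
Qed.

Lemma csummable_conj T (f : T -> R[i]) : csummable f ->
  csummable (fun x => conjc (f x)).
Proof. by move=> sf; apply: csummable_le sf _ => x; rewrite normc_conj. Qed.

Lemma csummable_bij T U (e : T -> U) (f : U -> R[i]) : bijective e ->
  csummable f -> csummable (f \o e).
Proof. by move=> be; apply: (abs_summable_bij be). Qed.

Lemma normc_le_psum T (f : T -> R[i]) x : csummable f ->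
  normc (f x) <= psum (fun x => normc (f x)).
Proof.
move=> sf; apply: (@psum_ge_at _ _ (fun x => normc (f x))) => // y.
exact: normc_ge0.
Qed.

Lemma csumD T (f g : T -> R[i]) : csummable f -> csummable g ->
  csum (fun x => f x + g x) = csum f + csum g.
Proof.
move=> sf sg; rewrite /csum.
rewrite (_ : (fun x => Re (f x + g x)) =
    fun x => Re (f x) + Re (g x)); last first.
  by apply/funext => x; case: (f x) => a b; case: (g x).
rewrite (_ : (fun x => Im (f x + g x)) =
    fun x => Im (f x) + Im (g x)); last first.
  by apply/funext => x; case: (f x) => a b; case: (g x).
have [sRf sIf] := (csummable_Re sf, csummable_Im sf).
have [sRg sIg] := (csummable_Re sg, csummable_Im sg).
by rewrite !rsumD.
Qed.

Lemma csumZ T c (f : T -> R[i]) : csummable f ->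
  csum (fun x => c * f x) = c * csum f.
Proof.
move=> sf; have sR := csummable_Re sf; have sI := csummable_Im sf.
case: c => a b; rewrite /csum.
rewrite (_ : (fun x => Re (Complex a b * f x)) =
    fun x => a * Re (f x) + (- b) * Im (f x)); last first.
  by apply/funext => x; case: (f x) => c d /=; rewrite mulNr.
rewrite (_ : (fun x => Im (Complex a b * f x)) =
    fun x => a * Im (f x) + b * Re (f x)); last first.
  by apply/funext => x; case: (f x) => c d /=.
rewrite !rsumD//; do ?[exact: abs_summableZ].
by rewrite !rsumZ// mulNr.
Qed.

Lemma csum_conj T (f : T -> R[i]) : csummable f ->
  csum (fun x => conjc (f x)) = conjc (csum f).
Proof.
move=> sf; rewrite /csum /= -rsumN; last exact: csummable_Im.
by congr Complex; congr rsum; apply/funext => x; case: (f x).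
Qed.

Lemma csum_bij T U (e : T -> U) (f : U -> R[i]) : bijective e ->
  csum (fun x => f (e x)) = csum f.
Proof.
move=> be; rewrite /csum -(rsum_bij (fun x => Re (f x)) be).
by rewrite -(rsum_bij (fun x => Im (f x)) be).
Qed.

Lemma csum_pt T (f : T -> R[i]) a : (forall x, x != a -> f x = 0) ->
  csum f = f a.
Proof.
move=> f0; rewrite /csum (@rsum_pt _ _ _ a) ?(@rsum_pt _ _ _ a).
- by case: (f a).
- by move=> x /f0 ->.
- by move=> x /f0 ->.
Qed.

Lemma csummable2_Re T U (F : T -> U -> R[i]) : csummable2 F ->
  abs_summable2 (fun x y => Re (F x y)).
Proof.
move=> sF; apply: abs_summable2_le sF _ => x y.
by rewrite [leRHS]ger0_norm ?normc_ge0// norm_Re_le_normc.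
Qed.

Lemma csummable2_Im T U (F : T -> U -> R[i]) : csummable2 F ->
  abs_summable2 (fun x y => Im (F x y)).
Proof.
move=> sF; apply: abs_summable2_le sF _ => x y.
by rewrite [leRHS]ger0_norm ?normc_ge0// norm_Im_le_normc.
Qed.

Lemma csummable2_at T U (F : T -> U -> R[i]) x : csummable2 F ->
  csummable (F x).
Proof. exact: abs_summable2_at. Qed.

Lemma exchange_csum T U (F : T -> U -> R[i]) : csummable2 F ->
  csum (fun x => csum (fun y => F x y)) = csum (fun y => csum (fun x => F x y)).
Proof.
move=> sF; rewrite /csum; congr Complex.
- exact/exchange_rsum/csummable2_Re.
- exact/exchange_rsum/csummable2_Im.
Qed.

(** The factor 2 is the price of bounding real and imaginary parts separately; the estimates built
    on it only need some constant. *)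
Lemma normc_csum_le T (f : T -> R[i]) : csummable f ->
  normc (csum f) <= 2 * psum (fun x => normc (f x)).
Proof.
move=> sf; apply: (le_trans (normc_le_ReIm _)) => /=.
rewrite mulr2n mulrDl mul1r; apply: lerD.
- apply: (le_trans (rsum_le_norm (csummable_Re sf))).
  by apply: le_psum => // x; exact: norm_Re_le_normc.
- apply: (le_trans (rsum_le_norm (csummable_Im sf))).
  by apply: le_psum => // x; exact: norm_Im_le_normc.
Qed.

Lemma abs_summable_psum_normc T U (F : T -> U -> R[i]) : csummable2 F ->
  abs_summable (fun x => psum (fun y => normc (F x y))).
Proof.
move=> /abs_summable_psum; congr abs_summable; apply/funext => x.
by congr psum; apply/funext => y; rewrite ger0_norm ?normc_ge0.
Qed.

Lemma csummable_csum T U (F : T -> U -> R[i]) : csummable2 F ->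
  csummable (fun x => csum (F x)).
Proof.
move=> sF.
apply: abs_summable_le (abs_summableZ 2 (abs_summable_psum_normc sF)) _ => x.
rewrite ger0_norm ?normc_ge0// (le_trans _ (ler_norm _))//.
exact/normc_csum_le/csummable2_at.
Qed.

Lemma csummable2_psum T U (F : T -> U -> R[i]) :
  (forall x, csummable (F x)) ->
  abs_summable (fun x => psum (fun y => normc (F x y))) -> csummable2 F.
Proof.
move=> sF s; apply: abs_summable2_psum => //.
by under eq_fun do under eq_fun do rewrite ger0_norm ?normc_ge0//.
Qed.

Lemma csum_split T (f : T -> R[i]) (s : seq T) : uniq s -> csummable f ->
  csum f = \sum_(i <- s) f i + csum (fun x => if x \in s then 0 else f x).
Proof.
move=> us sf.
rewrite /csum (rsum_split us (csummable_Re sf)).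
rewrite (rsum_split us (csummable_Im sf)).
have -> : \sum_(i <- s) f i =
    Complex (\sum_(i <- s) Re (f i)) (\sum_(i <- s) Im (f i)).
  elim: s {us} => [|a s IH]; first by rewrite !big_nil.
  by rewrite !big_cons IH; case: (f a).
rewrite -[RHS]/(Complex _ _); congr Complex; congr (_ + rsum _);
  by apply/funext => x; case: ifP.
Qed.

(** This connects [csum], for which linearity and Fubini are available, with the topological sum in
    [convolution]. A finite set carrying almost all of the sum of moduli controls the tail of every
    larger finite set. *)
Lemma summability_sumE T (f : T -> R[i]) : csummable f ->
  summability.sum (f : T -> R[i]^o) = csum f.
Proof.
move=> sf; have FF := @summability.totally_filter T.
apply: cvg_lim; first exact: norm_hausdorff.
apply/cvgrPdist_lt => e e0.
(* The norm of [R[i]] is complex-valued, and so is e; being positive in the order of [R[i]] forces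
   it to be real. *)
have [r0 er] : 0 < Re e /\ e = (Re e)%:C%C.
  by move: e0; rewrite ltcE /= => /andP[/eqP Ie ->]; case: e Ie => a b /= ->.
(* The tolerance is e / 3, because [normc_csum_le] doubles it and the final inequality is strict. *)
have [A hA] :=
  psum_approx (divr_gt0 r0 (ltr0Sn R 2)) (fun x => normc_ge0 (f x)) sf.
exists A => // B /= AB.
have -> : summability.partial_sum (f : T -> R[i]^o) B = \sum_(i <- B) f i.
  by rewrite /summability.partial_sum [RHS]big_seq_fsetE.
rewrite (csum_split (fset_uniq B) sf) addrAC subrr add0r er.
rewrite -[ `|_| ]/((normc _)%:C%C) ltcR.
have srest (C : {fset T}) : csummable (fun x => if x \in C then 0 else f x).
  apply: csummable_le sf _ => x; case: ifP => // _.
  by rewrite Normc.normc0 normc_ge0.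
apply: (le_lt_trans (normc_csum_le (srest B))).
have le : psum (fun x => normc (if x \in B then 0 else f x)) <=
    psum (fun x => if x \in A then 0 else normc (f x)).
  apply: le_psum => [x|x|]; first exact: normc_ge0.
    case: ifP => [_|/negP xB].
      by rewrite Normc.normc0; case: ifP => // _; exact: normc_ge0.
    by rewrite ifF//; apply/negP => /(fsubsetP AB).
  apply: abs_summable_le sf _ => x; case: ifP => // _.
  by rewrite normr0.
have := psum_split (fset_uniq A) (fun x => normc_ge0 (f x)) sf; lra.
Qed.
End ComplexSums.

(** * The star-algebra of summable functions on a group *)

Section GroupBijections.
Variable G : groupType.

Lemma mulgr_bij (c : G) : bijective (fun x : G => (x * c)%g).
Proof. by exists (fun x => (x * c^-1)%g) => x; rewrite ?mulgK ?mulgVK. Qed.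

Lemma invg_bij : bijective (fun x : G => (x^-1)%g).
Proof. by exists (fun x => (x^-1)%g) => x; rewrite invgK. Qed.

End GroupBijections.

(** * Convolution on the unweighted l^1(G) *)

Section Convolution.
Variables (R : realType) (G : groupType).
Implicit Types a b c : G -> R[i].
Local Notation Re := complex.Re.
Local Notation normc := (@Normc.normc R).

Definition conv a b : G -> R[i] :=
  fun z => csum (fun y => a (z * y^-1)%g * b y).

(** For fixed y the function of z is a translate of a times the scalar b y, with l^1-norm |b y|
    times that of a. The family is therefore summed over z first, and the order exchanged
    afterwards. *)
Lemma csummable2_conv a b : csummable a -> csummable b ->
  csummable2 (fun z y => a (z * y^-1)%g * b y).
Proof.
move=> sa sb; apply: abs_summable2C.
have sat y : csummable (fun z => a (z * y^-1)%g).
  exact: (csummable_bij (mulgr_bij _)).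
apply: (@csummable2_psum _ _ _ (fun y z => a (z * y^-1)%g * b y)) => [y|].
  by under eq_fun do rewrite mulrC; apply: csummableZ.
apply: abs_summable_le (abs_summableZ (psum (fun x => normc (a x))) sb) _ => y.
under eq_fun do rewrite Normc.normcM mulrC.
rewrite psumZ ?normc_ge0//; last 2 first.
- by move=> x; exact: normc_ge0.
- exact: sat.
by rewrite -(psum_bij (fun x => normc (a x)) (mulgr_bij y^-1)) mulrC.
Qed.

Lemma csummable_conv_at a b z : csummable a -> csummable b ->
  csummable (fun y => a (z * y^-1)%g * b y).
Proof. by move=> sa sb; apply: (csummable2_at z (csummable2_conv sa sb)). Qed.

Lemma csummable_conv a b : csummable a -> csummable b -> csummable (conv a b).
Proof. by move=> sa sb; apply/csummable_csum/csummable2_conv. Qed.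

Lemma convA a b c : csummable a -> csummable b -> csummable c ->
  conv a (conv b c) = conv (conv a b) c.
Proof.
move=> sa sb sc; apply/funext => z; rewrite /conv.
have s2 := csummable2_conv sb sc.
have s : csummable2 (fun v y => a (z * v^-1)%g * (b (v * y^-1)%g * c y)).
  apply: csummable2_psum => [v|].
    by apply/csummableZ/(csummable2_at v s2).
  (* The values of a are bounded by its l^1-norm K, which reduces the claim to [s2]. *)
  pose K := psum (fun x => normc (a x)).
  apply: abs_summable_le (abs_summableZ K (abs_summable_psum_normc s2)) _ => v.
  under eq_fun do rewrite Normc.normcM.
  rewrite psumZ ?normc_ge0//; last 2 first.
  - by move=> x; exact: normc_ge0.
  - exact: (csummable2_at v s2).
  rewrite !normrM ler_wpM2r// ger0_norm ?normc_ge0//.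
  by rewrite (le_trans _ (ler_norm _))// normc_le_psum.
transitivity (csum (fun v =>
    csum (fun y => a (z * v^-1)%g * (b (v * y^-1)%g * c y)))).
  by congr csum; apply/funext => v; rewrite csumZ//; apply: csummable_conv_at.
rewrite (exchange_csum s); congr csum; apply/funext => y.
rewrite mulrC -csumZ; last exact: csummable_conv_at.
(* Substitution u = v y^-1, under which z y^-1 u^-1 = z v^-1. *)
rewrite -(csum_bij (fun u => c y * (a (z * y^-1 * u^-1)%g * b u))
  (mulgr_bij y^-1)).
congr csum; apply/funext => v.
by rewrite invgM invgK -mulgA mulKg mulrA mulrC.
Qed.

Lemma conv_at1 a b : conv a b 1%g = csum (fun y => a y * b (y^-1)%g).
Proof.
rewrite /conv -(csum_bij _ (@invg_bij G)).
by congr csum; apply/funext => y; rewrite mul1g invgK.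
Qed.

Lemma conv_trace a b : conv a b 1%g = conv b a 1%g.
Proof.
rewrite conv_at1 /conv; congr csum; apply/funext => y.
by rewrite mul1g mulrC.
Qed.

Lemma csummable_delta_e : csummable (delta_e R G).
Proof.
rewrite /csummable /abs_summable (@esum_pt _ _ _ 1%g) ?ltry//.
move=> x /negbTE x1; rewrite /delta_e x1.
by rewrite Normc.normc0 normr0.
Qed.

Lemma conv1f a : conv (delta_e R G) a = a.
Proof.
apply/funext => z; rewrite /conv (csum_pt (a := z)).
  by rewrite /delta_e mulgV eqxx mul1r.
move=> y yz; rewrite /delta_e (_ : (_ == _) = false) ?mul0r//.
apply/negP => /eqP zy; move: yz; rewrite -(mulgVK y z) zy mul1g eqxx.
by [].
Qed.

Lemma convf1 a : conv a (delta_e R G) = a.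
Proof.
apply/funext => z; rewrite /conv (csum_pt (a := 1%g)).
  by rewrite /delta_e eqxx mulr1 invg1 mulg1.
by move=> y /negbTE y1; rewrite /delta_e y1 mulr0.
Qed.

End Convolution.

(** * The real tracial star-algebra l^1(G) *)

Section L1.
Variables (R : realType) (G : groupType).
Local Notation normc := (@Normc.normc R).

(** Summability is stored as a boolean so that [l1] is a subtype with irrelevant proofs and inherits
    the choice structure required by the algebraic hierarchy. *)
Record l1 := L1 { l1_fun :> G -> R[i]; l1P : `[< csummable l1_fun >] }.

HB.instance Definition _ := [isSub for l1_fun].
HB.instance Definition _ := [Choice of l1 by <:].

Implicit Types f g h : l1.

Lemma l1_csummable f : csummable f.
Proof. exact/asboolP/l1P. Qed.

Definition mkl1 (a : G -> R[i]) (sa : csummable a) : l1 := L1 (asboolT sa).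

Lemma l1_eq f g : (forall x, f x = g x) -> f = g.
Proof. by move=> fg; apply: val_inj; apply/funext. Qed.

Lemma csummable0 : csummable (fun _ : G => 0 : R[i]).
Proof.
rewrite /csummable /abs_summable esum1// => x _.
by rewrite Normc.normc0 normr0.
Qed.

Lemma csummableN (a : G -> R[i]) : csummable a -> csummable (fun x => - a x).
Proof.
move=> /(csummableZ (-1)); congr csummable.
by apply/funext => x; rewrite mulN1r.
Qed.

Definition l1_zero := mkl1 csummable0.
Definition l1_opp f := mkl1 (csummableN (l1_csummable f)).
Definition l1_add f g := mkl1 (csummableD (l1_csummable f) (l1_csummable g)).

Lemma l1_addA : associative l1_add.
Proof. by move=> f g h; apply: l1_eq => x /=; rewrite addrA. Qed.
Lemma l1_addC : commutative l1_add.
Proof. by move=> f g; apply: l1_eq => x /=; rewrite addrC. Qed.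
Lemma l1_add0 : left_id l1_zero l1_add.
Proof. by move=> f; apply: l1_eq => x /=; rewrite add0r. Qed.
Lemma l1_addN : left_inverse l1_zero l1_opp l1_add.
Proof. by move=> f; apply: l1_eq => x /=; rewrite addNr. Qed.

HB.instance Definition _ :=
  GRing.isZmodule.Build l1 l1_addA l1_addC l1_add0 l1_addN.

Definition l1_one := mkl1 (csummable_delta_e R G).
Definition l1_mul f g :=
  mkl1 (csummable_conv (l1_csummable f) (l1_csummable g)).

Lemma l1_mul_summable f g z : csummable (fun y => f (z * y^-1)%g * g y).
Proof. exact: csummable_conv_at (l1_csummable f) (l1_csummable g). Qed.

Lemma l1_mulA : associative l1_mul.
Proof.
by move=> f g h; apply: val_inj; rewrite /= convA//; exact: l1_csummable.
Qed.
Lemma l1_mul1 : left_id l1_one l1_mul.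
Proof. by move=> f; apply: val_inj; rewrite /= conv1f. Qed.
Lemma l1_mulr1 : right_id l1_one l1_mul.
Proof. by move=> f; apply: val_inj; rewrite /= convf1. Qed.
Lemma l1_mulDl : left_distributive l1_mul +%R.
Proof.
move=> f g h; apply: l1_eq => z /=.
rewrite /conv -csumD; try exact: l1_mul_summable.
by congr csum; apply/funext => y; rewrite mulrDl.
Qed.
Lemma l1_mulDr : right_distributive l1_mul +%R.
Proof.
move=> f g h; apply: l1_eq => z /=.
rewrite /conv -csumD; try exact: l1_mul_summable.
by congr csum; apply/funext => y; rewrite mulrDr.
Qed.
Lemma l1_one_neq0 : l1_one != 0.
Proof.
apply/eqP => /(congr1 (fun f : l1 => f 1%g)) /=.
by rewrite /delta_e eqxx => /eqP; rewrite oner_eq0.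
Qed.

HB.instance Definition _ := GRing.Zmodule_isNzRing.Build l1
  l1_mulA l1_mul1 l1_mulr1 l1_mulDl l1_mulDr l1_one_neq0.

(* Real scalars suffice, since only the real part of the trace is used. *)
Definition l1_scale (c : R) f := mkl1 (csummableZ c%:C%C (l1_csummable f)).

Lemma l1_scaleA c d f : l1_scale c (l1_scale d f) = l1_scale (c * d) f.
Proof. by apply: l1_eq => x /=; rewrite mulrA rmorphM. Qed.
Lemma l1_scale1 : left_id 1 l1_scale.
Proof. by move=> f; apply: l1_eq => x /=; rewrite mul1r. Qed.
Lemma l1_scaleDr : right_distributive l1_scale +%R.
Proof. by move=> c f g; apply: l1_eq => x /=; rewrite mulrDr. Qed.
Lemma l1_scaleDl f : {morph l1_scale^~ f : c d / c + d}.
Proof. by move=> c d; apply: l1_eq => x /=; rewrite rmorphD mulrDl. Qed.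

HB.instance Definition _ := GRing.Zmodule_isLmodule.Build R l1
  l1_scaleA l1_scale1 l1_scaleDr l1_scaleDl.

Lemma l1_scaleAl (c : R) (f g : l1) : c *: (f * g) = c *: f * g.
Proof.
apply: l1_eq => z /=; rewrite /conv -csumZ.
  by congr csum; apply/funext => y; rewrite mulrA.
exact: l1_mul_summable.
Qed.
Lemma l1_scaleAr (c : R) (f g : l1) : c *: (f * g) = f * (c *: g).
Proof.
apply: l1_eq => z /=; rewrite /conv -csumZ.
  by congr csum; apply/funext => y; rewrite mulrCA.
exact: l1_mul_summable.
Qed.

HB.instance Definition _ := GRing.Lmodule_isLalgebra.Build R l1 l1_scaleAl.
HB.instance Definition _ := GRing.Lalgebra_isAlgebra.Build R l1 l1_scaleAr.

Lemma csummable_star (a : G -> R[i]) : csummable a ->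
  csummable (fun x => conjc (a (x^-1)%g)).
Proof.
move=> sa; apply: (@csummable_conj _ _ (fun x => a (x^-1)%g)).
exact: csummable_bij (@invg_bij G) sa.
Qed.

Definition l1_star f := mkl1 (csummable_star (l1_csummable f)).
Definition l1_trace f : R := complex.Re (f 1%g).

Lemma l1_starD : {morph l1_star : f g / f + g}.
Proof. by move=> f g; apply: l1_eq => x /=; rewrite rmorphD. Qed.

Lemma l1_starZ (c : R) f : l1_star (c *: f) = c *: l1_star f.
Proof. by apply: l1_eq => x /=; case: (f _) => a b /=; simpc. Qed.

Lemma l1_starM f g : l1_star (f * g) = l1_star g * l1_star f.
Proof.
apply: l1_eq => z; rewrite -[LHS]/(conjc (conv f g (z^-1)%g)).
rewrite -[RHS]/(conv (l1_star g) (l1_star f) z) /conv -csum_conj;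
  last exact: l1_mul_summable.
rewrite -[RHS](csum_bij _ (mulgr_bij z)); congr csum; apply/funext => y /=.
by rewrite !invgM !invgK mulgK rmorphM mulrC.
Qed.

Lemma l1_starK : involutive l1_star.
Proof. by move=> f; apply: l1_eq => x /=; rewrite conjcK invgK. Qed.

Lemma l1_traceC f g : l1_trace (f * g) = l1_trace (g * f).
Proof. exact: (congr1 (@complex.Re R) (conv_trace f g)). Qed.

Lemma l1_traceM f g :
  l1_trace (f * g) = complex.Re (csum (fun y => f y * g (y^-1)%g)).
Proof. exact: (congr1 (@complex.Re R) (conv_at1 f g)). Qed.

Lemma l1_trace_star f : l1_trace (l1_star f) = l1_trace f.
Proof. by rewrite /l1_trace /= invg1; case: (f _). Qed.

Let sq f x := normc (f x) ^+ 2.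

Let sq_ge0 f x : 0 <= sq f x. Proof. exact: sqr_ge0. Qed.

(** l^1 is contained in l^2: f is bounded by its l^1-norm K, so |f|^2 <= K |f|. *)
Let sq_summable f : abs_summable (sq f).
Proof.
pose K := psum (fun x => normc (f x)).
apply: abs_summable_le (abs_summableZ K (l1_csummable f)) _ => x.
have n0 y : 0 <= normc (f y) by exact: normc_ge0.
rewrite ger0_norm// ger0_norm ?mulr_ge0 ?psum_ge0//.
by rewrite /sq expr2 ler_wpM2r// normc_le_psum//; exact: l1_csummable.
Qed.

Let trace_sq f : l1_trace (f * l1_star f) = psum (sq f).
Proof.
rewrite l1_traceM -rsum_ge0E//; congr rsum; apply/funext => x.
rewrite /= invgK /sq; case: (f x) => a b /=.
by rewrite sqr_sqrtr ?addr_ge0 ?sqr_ge0//; ring.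
Qed.

Lemma l1_trace_ge0 f : 0 <= l1_trace (f * l1_star f).
Proof. by rewrite trace_sq psum_ge0. Qed.

Lemma l1_trace_eq0 f : l1_trace (f * l1_star f) = 0 -> f = 0.
Proof.
rewrite trace_sq => f0; apply: l1_eq => x /=; apply: Normc.eq0_normc.
apply/eqP; rewrite -sqrf_eq0 eq_le sqr_ge0 andbT -f0.
exact: (psum_ge_at x (sq_ge0 f) (sq_summable f)).
Qed.

(* [2 |f (u y^-1)| |f u| <= |f (u y^-1)| ^ 2 + |f u| ^ 2], and both terms on the
   right sum over [u] to [psum (sq f)]. *)
Let star_mul_le f y : normc ((l1_star f * f) y) <= 2 * psum (sq f).
Proof.
have sfy : csummable (fun u => l1_star f (y * u^-1)%g * f u).
  exact: l1_mul_summable.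
apply: (le_trans (normc_csum_le sfy)); rewrite ler_pM2l//.
have be := @mulgr_bij G y^-1.
have s1 : abs_summable (fun u => sq f (u * y^-1)%g).
  exact: (abs_summable_bij be (sq_summable f)).
have E : psum (sq f) =
    psum (fun u => 2^-1 * (sq f (u * y^-1)%g + sq f u)).
  rewrite psumZ ?invr_ge0//; last 2 first.
  - by move=> u; rewrite addr_ge0.
  - exact: abs_summableD.
  by rewrite psumD// (psum_bij (sq f) be); field.
rewrite E; apply: le_psum => [u|u|]; first exact: normc_ge0.
  rewrite Normc.normcM /= normc_conj invgM invgK /sq.
  by have := sqr_ge0 (normc (f (u / y)%g) - normc (f u)); lra.
exact/abs_summableZ/abs_summableD.
Qed.

(** By the trace property the left side is T (g h) with h = f^* f, and h is uniformly bounded by a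
    multiple of the square l^2-norm of f. The constant 4 is the factor 2 of [star_mul_le] times that
    of [normc_csum_le]. *)
Lemma l1_trace_bounded g : exists K, forall f,
  l1_trace (f * g * l1_star f) <= K * l1_trace (f * l1_star f).
Proof.
exists (4 * psum (fun x => normc (g x))) => f.
rewrite l1_traceC mulrA l1_traceC trace_sq l1_traceM.
set h := l1_star f * f; pose q := psum (sq f).
have hq y : normc (h (y^-1)%g) <= 2 * q by exact: star_mul_le.
have sgh : csummable (fun y => g y * h (y^-1)%g).
  under eq_fun do rewrite mulrC.
  exact: csummableMr_bounded hq (l1_csummable g).
have q0 : 0 <= q by apply: psum_ge0.
apply: (le_trans (ler_norm _)); apply: (le_trans (norm_Re_le_normc _)).
apply: (le_trans (normc_csum_le sgh)).
rewrite -/q (_ : 4 * _ * _ = 2 * (2 * q * psum (fun x => normc (g x))));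
  last by ring.
rewrite ler_pM2l// -psumZ ?mulr_ge0//; last 2 first.
- by move=> x; exact: normc_ge0.
- exact: l1_csummable.
apply: le_psum => [y|y|]; first exact: normc_ge0.
  by rewrite Normc.normcM mulrC ler_wpM2r ?normc_ge0.
exact/abs_summableZ/l1_csummable.
Qed.

Lemma l1_directly_finite f g : f * g = 1 -> g * f = 1.
Proof.
apply: (@tracial_directly_finite R (l1 : algType R) l1_star l1_trace).
- exact: l1_starD.
- exact: l1_starZ.
- exact: l1_starM.
- exact: l1_starK.
- by move=> x y; rewrite /l1_trace /= raddfD.
- by move=> c x; rewrite /l1_trace /=; case: (x _) => a b /=; simpc.
- by rewrite /l1_trace /= /delta_e eqxx.
- exact: l1_traceC.
- exact: l1_trace_star.
- exact: l1_trace_ge0.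
- exact: l1_trace_eq0.
- exact: l1_trace_bounded.
Qed.

End L1.

(** * Reduction to the trivial weight *)

Lemma bounded_funP (R : realType) (T : Type) (f : T -> R) (K : R) :
  (forall x, `|f x| <= K) -> bounded_fun f.
Proof.
move=> fK; exists K; split=> [|M KM x _]; first exact: num_real.
exact: le_trans (fK x) (ltW KM).
Qed.

(* [ln \o chi] is the mean over [y] of the bounded function
   [ln (w (x * y)) - ln (w y)], which is a cocycle in [x]. *)
Lemma character_le_weight (R : realType) (G : groupType) (w : G -> R) :
  amenable R G -> weight w ->
  exists chi : G -> R, [/\ forall x, 0 < chi x,
    forall x y, chi (x * y)%g = chi x * chi y & forall x, chi x <= w x].
Proof.
move=> [m [mlin mpos m1 minv]] [w0 wM].
pose F x y := ln (w (x * y)%g) - ln (w y).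
have F_le x y : F x y <= ln (w x).
  by rewrite lerBlDr -lnM ?posrE// ler_ln ?posrE ?mulr_gt0.
(* Since F (x^-1) (x y) = - F x y, the upper bound at x^-1 is a lower bound at x; this makes each
   [F x] bounded, hence in the domain of the mean. *)
have F_ge x y : - ln (w (x^-1)%g) <= F x y.
  have := F_le (x^-1)%g (x * y)%g; rewrite /F mulKg; lra.
have F_norm x y : `|F x y| <= `|ln (w x)| + `|ln (w (x^-1)%g)|.
  have := F_le x y; have := F_ge x y.
  have := ler_norm (ln (w x)); have := ler_norm (ln (w (x^-1)%g)).
  have := normr_ge0 (ln (w x)); have := normr_ge0 (ln (w (x^-1)%g)).
  by rewrite ler_norml => *; apply/andP; split; lra.
have bF x : bounded_fun (F x) := bounded_funP (F_norm x).
have bcst (c : R) : bounded_fun (fun _ : G => c).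
  exact: (@bounded_funP _ _ _ `|c|).
(* Linearity is given only in the form c f + g, so 0 is written as (-1) 1 + 1; pure scaling then
   follows with g = 0. *)
have m0 : m (fun=> 0) = 0.
  have := mlin (-1) (fun=> 1) (fun=> 1) (bcst 1) (bcst 1).
  by under eq_fun do rewrite mulN1r addNr; rewrite m1 mulN1r addNr.
have mcst c : m (fun=> c) = c.
  have := mlin c (fun=> 1) (fun=> 0) (bcst 1) (bcst 0).
  by under eq_fun do rewrite mulr1 addr0; rewrite m0 m1 mulr1 addr0.
exists (fun x => expR (m (F x))); split=> [x|x y|x]; first exact: expR_gt0.
  rewrite -expRD; congr expR.
  have bFy : bounded_fun (fun z => F x (y^-1^-1 * z)%g).
    by apply: bounded_funP => z; apply: F_norm.
  (* The cocycle identity is F (x y) z = F x (y z) + F y z; invariance under y^-1 removes the shift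
     by y in the first term. *)
  rewrite -(minv (y^-1)%g _ (bF x)) -[X in X + _]mul1r -mlin//.
  congr m; apply/funext => z.
  by rewrite /F invgK mulgA mul1r addrA subrK.
rewrite -[leRHS]lnK ?posrE// ler_expR.
have := mlin (-1) (F x) (fun=> ln (w x)) (bF x) (bcst _).
rewrite mcst mulN1r => E; rewrite -subr_ge0 addrC -E.
(* Positivity of the mean on the nonnegative function ln (w x) - F x y gives m (F x) <= ln (w x). *)
apply: mpos => [|y]; last by have := F_le x y; lra.
apply: (@bounded_funP _ _ _
  ((`|ln (w x)| + `|ln (w (x^-1)%g)|) + `|ln (w x)|)) => y.
by rewrite mulN1r (le_trans (ler_normD _ _))// normrN lerD2r.
Qed.

Section Twist.
Variables (R : realType) (G : groupType) (w chi : G -> R).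
Hypothesis chi_gt0 : forall x, 0 < chi x.
Hypothesis chiM : forall x y, chi (x * y)%g = chi x * chi y.
Hypothesis chi_le : forall x, chi x <= w x.

Definition twist (a : G -> R[i]) x : R[i] := (chi x)%:C%C * a x.

Lemma csummable_twist a : weighted_l1 w a -> csummable (twist a).
Proof.
apply: le_lt_trans; apply: le_esum => x _.
rewrite lee_fin ger0_norm ?normc_ge0// Normc.normcM mulrC.
rewrite ler_wpM2l ?normc_ge0// /= expr0n addr0 sqrtr_sqr.
by rewrite gtr0_norm.
Qed.

Lemma conv_twist a b z : csummable (twist a) -> csummable (twist b) ->
  conv (twist a) (twist b) z = (chi z)%:C%C * convolution a b z.
Proof.
move=> sa sb.
have chi0 : (chi z)%:C%C != 0 :> R[i] by rewrite eq_complex /= gt_eqF.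
have E y : twist a (z * y^-1)%g * twist b y =
    (chi z)%:C%C * (a (z * y^-1)%g * b y).
  rewrite /twist.
  have -> : chi z = chi (z * y^-1)%g * chi y by rewrite -chiM mulgVK.
  by rewrite rmorphM mulrACA.
(* Neither a nor b need be summable without the weight, but at fixed z the twisted and untwisted
   terms differ by the nonzero constant chi z, so the convolution sum still converges absolutely. *)
have s : csummable (fun y => a (z * y^-1)%g * b y).
  have := csummableZ ((chi z)%:C%C)^-1 (csummable_conv_at z sa sb).
  by congr csummable; apply/funext => y; rewrite E mulKf.
by rewrite /conv (funext E) csumZ// /convolution summability_sumE.
Qed.

Lemma twist_delta z : (chi z)%:C%C * delta_e R G z = delta_e R G z.
Proof.
rewrite /delta_e; case: eqVneq => [->|_]; last by rewrite mulr0.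
suff -> : chi 1%g = 1 by rewrite mul1r.
by apply: (mulfI (lt0r_neq0 (chi_gt0 1%g))); rewrite -chiM mulg1 mulr1.
Qed.

End Twist.

Theorem proposition7 (R : realType) (G : groupType) (w : G -> R)
    (amenG : amenable R G) (ww : weight w) (a b : G -> R[i])
    (al1 : weighted_l1 w a) (bl1 : weighted_l1 w b)
    (ab1 : convolution a b = delta_e R G) :
  convolution b a = delta_e R G.
Proof.
have [chi [chi0 chiM chi_le]] := character_le_weight amenG ww.
have sa := csummable_twist chi0 chi_le al1.
have sb := csummable_twist chi0 chi_le bl1.
have ab : mkl1 sa * mkl1 sb = 1.
  apply: l1_eq => z; rewrite -[LHS]/(conv (twist chi a) (twist chi b) z).
  by rewrite conv_twist// ab1 twist_delta.
have /(congr1 (fun f : l1 R G => f : G -> R[i])) ba := l1_directly_finite ab.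
apply/funext => z.
have chiz : (chi z)%:C%C != 0 :> R[i] by rewrite eq_complex /= gt_eqF.
apply: (mulfI chiz); rewrite (twist_delta chi0 chiM) -conv_twist//.
exact: (congr1 (@^~ z) ba).
Qed.
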